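(* For all integers $k\ge 4$ and $n\ge 1$, \[ \mathrm{ex}_3(n, \{\textup{Berge-}C_2, \dots, \textup{Berge-}C_k\})=\mathrm{ex}(n, K_3, \{ C_4,\dots, C_k\}). \]
   Context: Graphs are finite and simple; hypergraphs are finite, without repeated hyperedges. For a graph $F$, a hypergraph $\mathcal{H}$ is a Berge-$F$ if (with $V(F)\subseteq V(\mathcal H)$, up to isomorphism) there is a bijection $f : E(F) \rightarrow E(\mathcal{H})$ such that $e \subseteq f(e)$ for every $e \in E(F)$. $C_i$ is the cycle on $i$ vertices. For $i=2$, $C_2$ is a pair of parallel edges on two vertices, so a Berge-$C_2$ consists of two distinct hyperedges sharing at least two vertices. $\mathrm{ex}_3(n,\{\textup{Berge-}F_1,\dots,\textup{Berge-}F_m\})$ denotes the maximum number of hyperedges in a $3$-uniform $n$-vertex hypergraph with no subhypergraph isomorphic to any Berge-$F_i$, for all $1\le i\le m$. $\mathrm{ex}(n,H,\{F_1,\dots,F_m\})$ denotes the maximum number of copies of the graph $H$ (subgraphs isomorphic to $H$) in an $n$-vertex graph that contains no $F_i$ as a (not necessarily induced) subgraph, for all $1\le i\le m$. *)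

(* Defs.v *)
From mathcomp Require Import all_boot.
Set Implicit Arguments.
Unset Strict Implicit.
Unset Printing Implicit Defensive.

(* Multigraphs (loops and parallel edges allowed) are needed because C_2 is a
   pair of parallel edges.  Edges form a type of their own, with their sets of
   endpoints. *)
Record multigraph := Multigraph {
  vertex : finType;
  edge : finType;
  ends : edge -> {set vertex};
  _ : forall e, 0 < #|ends e| <= 2 }.

Definition cycle_ends i (j : 'I_i) : {set 'I_i} := [set j; ordS j].

Fact cycle_ends_card i (j : 'I_i) : 0 < #|cycle_ends j| <= 2.
Proof. by rewrite cards2; case: (_ != _). Qed.

(* C_i: edge j joins j to j + 1 mod i.  For i = 2 the two edges 0 and 1 have
   the same endpoints, and for i >= 3 the graph is simple. *)
Definition cycle_graph (i : nat) : multigraph :=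
  Multigraph (@cycle_ends_card i).

Fact complete_ends_card m (e : {e : {set 'I_m} | #|e| == 2}) :
  0 < #|val e| <= 2.
Proof. by case: e => e /= /eqP ->. Qed.

Definition complete_graph (m : nat) : multigraph :=
  Multigraph (@complete_ends_card m).

(* A simple graph or hypergraph with vertex set T is its set of (hyper)edges
   E : {set {set T}}; a sub(hyper)graph of it is a pair X of a vertex set X.1
   and a set X.2 of (hyper)edges. *)
Section Containment.
Variable T : finType.
Implicit Types (F : multigraph) (E : {set {set T}}).
Implicit Types X : {set T} * {set {set T}}.

Definition uniform (r : nat) E : bool := [forall e in E, #|e| == r].

Definition subhypergraph E X : bool :=
  (X.2 \subset E) && [forall e in X.2, e \subset X.1].

Definition isomorphic F X : bool :=
  [exists phi : {ffun vertex F -> T}, exists f : {ffun edge F -> {set T}},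
    [&& injectiveb phi, phi @: setT == X.1,
        injectiveb f, f @: setT == X.2
      & [forall e, f e == phi @: ends e]]].

Definition copies F E : {set {set T} * {set {set T}}} :=
  [set X | subhypergraph E X && isomorphic F X].

Definition subgraph_free F E : bool := copies F E == set0.

(* The injection phi is the identification V(F) \subseteq V(X) up to
   isomorphism. *)
Definition is_berge F X : bool :=
  [exists phi : {ffun vertex F -> T}, exists f : {ffun edge F -> {set T}},
    [&& injectiveb phi, phi @: setT \subset X.1,
        injectiveb f, f @: setT == X.2
      & [forall e, phi @: ends e \subset f e]]].

Definition berge_free F E : bool :=
  ~~ [exists X, subhypergraph E X && is_berge F X].

End Containment.

Definition ex_berge (r n : nat) (Fs : seq multigraph) : nat :=
  \max_(E : {set {set 'I_n}} |
          uniform r E && all (fun F => berge_free F E) Fs) #|E|.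

Definition ex_copies (n : nat) (H : multigraph) (Fs : seq multigraph) : nat :=
  \max_(E : {set {set 'I_n}} |
          uniform 2 E && all (fun F => subgraph_free F E) Fs) #|copies H E|.

(* Main.v *)
Require Import Defs.
From mathcomp Require Import all_boot.
Set Implicit Arguments.
Unset Strict Implicit.
Unset Printing Implicit Defensive.

(** Both inequalities come from an explicit construction on the same vertices.

    From a 3-uniform hypergraph without short Berge cycles, pass to its shadow,
    the graph of all pairs covered by a hyperedge.  Every hyperedge spans a
    triangle of the shadow, and distinct hyperedges span distinct triangles.
    The shadow has no cycle of length i between 4 and k ([shadow_cycle]):
    choosing a hyperedge over every edge of such a cycle gives a closed walk
    v_0 h_0 v_1 h_1 ... with distinct vertices, in which the hyperedges are not
    all equal because a single one has only 3 < i vertices.  If some hyperedge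
    occurs twice, it can be used to shortcut either of the two arcs between its
    occurrences, and at least one of the two shorter closed walks still carries
    two different hyperedges.  A walk that can no longer be shortened is a Berge
    cycle of length at least 2 and at most i ([berge_cycle_of_closed_walk]).

    From a graph without C_4, ..., C_k, pass to the hypergraph of vertex sets of
    its triangles; a triangle is determined by its vertex set
    ([copies_completeE]).  A Berge cycle of length i >= 4 in it has a cycle of
    length i of the graph as its core.  The short ones are excluded by C_4
    alone ([triangle_berge_cycle]): in a Berge-C_2, two triangles on a common
    edge uv have different third vertices, which form a C_4 with u and v; in a
    Berge-C_3 with core uvw, at most one of the hyperedges is {u, v, w}, and
    another one, say {u, v, a}, gives the 4-cycle u a v w. *)

(** * Cyclic sequences *)

Lemma ordS_neq i (j : 'I_i) : 1 < i -> ordS j != j.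
Proof.
move=> i_gt1; rewrite -val_eqE /=.
have := ltn_ord j; rewrite leq_eqVlt => /orP[/eqP ij | ltji].
  by rewrite ij modnn; case: (val j) ij i_gt1 => //= <-.
by rewrite modn_small // gtn_eqF.
Qed.

Lemma ordS2_neq i (j : 'I_i) : 2 < i -> ordS (ordS j) != j.
Proof.
move=> i_gt2; rewrite -val_eqE /= -addn1 modnDml addn1.
have := ltn_ord j; rewrite leq_eqVlt => /orP[/eqP ij | ].
  rewrite -[_.+2]addn1 -modnDml ij modnn add0n modn_small ?(ltn_trans _ i_gt2) //.
  by rewrite -eqSS ij ltn_eqF.
rewrite leq_eqVlt => /orP[/eqP ij | ltji].
  by rewrite ij modnn; case: (val j) ij i_gt2 => //= <-.
by rewrite modn_small // gtn_eqF // leqW.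
Qed.

(** Links [path]'s cycles to the successor on ['I_i] that indexes the edges of
    [cycle_graph i]. *)
Lemma cycle_tnthP (A : Type) (e : rel A) i (t : i.-tuple A) :
  reflect (forall j, e (tnth t j) (tnth t (ordS j))) (cycle e t).
Proof.
case: i t => [|i] t; first by rewrite tuple0; constructor; case.
have x0 := tnth t ord0.
have sz : size t = i.+1 by rewrite size_tuple.
have nthS (j : 'I_i.+1) :
    nth x0 t (ordS j) = nth x0 (rcons (behead t) (head x0 t)) j.
  rewrite nth_rcons size_behead sz /= nth_behead.
  have := ltn_ord j; rewrite ltnS leq_eqVlt => /orP[/eqP-> | ltji].
    by rewrite modnn ltnn eqxx nth0.
  by rewrite ltji modn_small.
have -> : cycle e t = path e (head x0 t) (rcons (behead t) (head x0 t)).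
  by case: (tval t) sz.
have hbt : head x0 t :: behead t = t by case: (tval t) sz.
have nthR j : j < i.+1 ->
    nth x0 (head x0 t :: rcons (behead t) (head x0 t)) j = nth x0 t j.
  by move=> ltj; rewrite -rcons_cons hbt nth_rcons sz ltj.
apply: (iffP (pathP x0)) => [te j | te j].
  have /te : j < size (rcons (behead t) (head x0 t)).
    by rewrite size_rcons size_behead sz.
  by rewrite -nthS nthR // !(tnth_nth x0).
rewrite size_rcons size_behead sz => ltj.
by have := te (Ordinal ltj); rewrite !(tnth_nth x0) nthS nthR.
Qed.

Lemma uniq_cycle_neq (A : eqType) (s : seq A) :
  uniq s -> 1 < size s -> cycle (fun x y => x != y) s.
Proof.
move=> /(tuple_uniqP (in_tuple s)) inj_s s_gt1.
apply/(cycle_tnthP _ (in_tuple s)) => j.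
by rewrite (inj_eq inj_s) eq_sym ordS_neq.
Qed.

Section Graphs.
Variable T : finType.
Implicit Types (E : {set {set T}}) (s : seq T) (b : seq (T * {set T})).

(** * Cycles, Berge cycles and cliques as sequences and sets *)

Definition adjacent E : rel T := fun x y => [set x; y] \in E.

(** A Berge cycle is handled as a sequence of pairs: a core vertex, and the
    hyperedge that joins it to the core vertex of the next pair. *)
Definition incident : rel (T * {set T}) :=
  fun p q => (p.1 \in p.2) && (q.1 \in p.2).

(** For i = 2 this would fail: the two parallel edges of C_2 cannot be mapped
    injectively to edges of a simple graph. *)
Lemma subgraph_free_cycleP E i : 2 < i ->
  reflect (exists s, [/\ size s = i, uniq s & cycle (adjacent E) s])
          (~~ subgraph_free (cycle_graph i) E).
Proof.
move=> i_gt2; rewrite /subgraph_free; apply: (iffP (set0Pn _)) =>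
  [[X] | [s [sz s_uniq s_cyc]]].
  rewrite !inE => /andP[/andP[XE _] /existsP[phi /existsP[f]]].
  move=> /and5P[/injectiveP inj_phi _ _ /eqP fX /forallP fE].
  pose t := [tuple phi j | j < i]; exists t; split; first exact: size_tuple.
    by apply/tuple_uniqP => j j'; rewrite !tnth_mktuple => /inj_phi.
  apply/cycle_tnthP => j; rewrite !tnth_mktuple; apply: (subsetP XE).
  have := eqP (fE j); rewrite /= /cycle_ends imsetU1 imset_set1 => <-.
  by rewrite -fX imset_f.
subst i; pose f := [ffun j : 'I_(size s) =>
                        [set tnth (in_tuple s) j; tnth (in_tuple s) (ordS j)]].
have inj_s := tuple_uniqP (in_tuple s) s_uniq.
exists ([set x in s], f @: setT); rewrite !inE; apply/andP; split.
  rewrite /subhypergraph /=; apply/andP; split; [apply/subsetP | apply/forall_inP].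
    move=> _ /imsetP[j _ ->]; rewrite ffunE.
    exact: (cycle_tnthP _ (in_tuple s) s_cyc).
  move=> _ /imsetP[j _ ->]; rewrite ffunE; apply/subsetP => x; rewrite !inE.
  by case/orP=> /eqP->; rewrite mem_tnth.
apply/existsP; exists [ffun j : 'I_(size s) => tnth (in_tuple s) j].
apply/existsP; exists f; apply/and5P; split => //.
- by apply/injectiveP => j j'; rewrite !ffunE => /inj_s.
- apply/eqP/setP => x; rewrite !inE; apply/imsetP/idP => [[j _ ->] | ].
    by rewrite ffunE mem_tnth.
  by case/seq_tnthP => j ->; exists j; rewrite ?ffunE.
- (* Two edges of the cycle with the same ends {j, j+1} = {j', j'+1} would
     otherwise give j' + 2 = j'. *)
  apply/injectiveP => j j'; rewrite !ffunE => jj'.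
  have := set21 (tnth (in_tuple s) j) (tnth (in_tuple s) (ordS j)).
  rewrite jj' !inE !(inj_eq inj_s) => /orP[/eqP // | /eqP jE].
  have := set22 (tnth (in_tuple s) j) (tnth (in_tuple s) (ordS j)).
  rewrite jj' !inE !(inj_eq inj_s) jE.
  case/orP=> /eqP jE'.
    by have := ordS2_neq j' i_gt2; rewrite jE' eqxx.
  by have := ordS_neq (ordS j') (ltnW i_gt2); rewrite jE' eqxx.
- apply/forallP => j.
  by rewrite ffunE /= /cycle_ends imsetU1 imset_set1 !ffunE.
Qed.

Lemma berge_free_cycleP E i :
  reflect (exists b, [/\ size b = i, uniq (unzip1 b), uniq (unzip2 b),
                         {subset unzip2 b <= E} & cycle incident b])
          (~~ berge_free (cycle_graph i) E).
Proof.
rewrite negbK; apply: (iffP existsP) => [[X] | [b [<- b1_uniq b2_uniq bE b_cyc]]].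
  case/andP=> /andP[XE _] /existsP[phi /existsP[f]].
  move=> /and5P[/injectiveP inj_phi _ /injectiveP inj_f /eqP fX /forallP fE].
  pose t := [tuple (phi j, f j) | j < i].
  exists t; split; first exact: size_tuple.
  - apply/(tuple_uniqP [tuple of unzip1 t]) => j j'.
    by rewrite !tnth_map !tnth_ord_tuple => /inj_phi.
  - apply/(tuple_uniqP [tuple of unzip2 t]) => j j'.
    by rewrite !tnth_map !tnth_ord_tuple => /inj_f.
  - move=> h /(tnthP [tuple of unzip2 t])[j ->].
    by rewrite !tnth_map tnth_ord_tuple; apply: (subsetP XE); rewrite -fX; apply: imset_f.
  apply/cycle_tnthP => j; rewrite !tnth_mktuple.
  have := fE j; rewrite /= /cycle_ends imsetU1 imset_set1 subUset !sub1set.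
  by [].
pose t := in_tuple b.
have inj1 : injective (fun j => (tnth t j).1).
  move=> j j'; rewrite -!(tnth_map fst).
  exact: (tuple_uniqP [tuple of map fst t] b1_uniq).
have inj2 : injective (fun j => (tnth t j).2).
  move=> j j'; rewrite -!(tnth_map snd).
  exact: (tuple_uniqP [tuple of map snd t] b2_uniq).
pose f := [ffun j => (tnth t j).2].
exists (setT, f @: setT); apply/andP; split.
  apply/andP; split; last by apply/forall_inP => h _; apply: subsetT.
  apply/subsetP => _ /imsetP[j _ ->]; rewrite ffunE.
  by apply/bE/map_f/mem_tnth.
apply/existsP; exists [ffun j => (tnth t j).1].
apply/existsP; exists f; apply/and5P; split => //.
- by apply/injectiveP => j j'; rewrite !ffunE => /inj1.
- exact: subsetT.
- by apply/injectiveP => j j'; rewrite !ffunE => /inj2.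
apply/forallP => j; have := cycle_tnthP _ t b_cyc j.
by rewrite /= /cycle_ends imsetU1 imset_set1 !ffunE subUset !sub1set.
Qed.

Definition pairs (h : {set T}) : {set {set T}} :=
  [set e in powerset h | #|e| == 2].

Definition cliques m E : {set {set T}} :=
  [set h : {set T} | (#|h| == m) && (pairs h \subset E)].

Lemma imset_complete_ends m (phi : 'I_m -> T) : injective phi ->
  [set phi @: ends e | e : edge (complete_graph m) in setT] = pairs (phi @: setT).
Proof.
move=> inj_phi; apply/setP => e; rewrite !inE.
apply/imsetP/andP => [[e' _ ->] | [eT /eqP e2]].
  by rewrite imsetS ?subsetT // card_imset // (valP e').
have eE : e = phi @: (phi @^-1: e).
  apply/setP => x; apply/idP/imsetP => [xe | [j] /[!inE] je -> //].
  have /imsetP[j _ xj] := subsetP eT x xe.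
  by exists j; rewrite // inE -xj.
have e'2 : #|phi @^-1: e| == 2 by rewrite -e2 {2}eE card_imset.
by exists (Sub (phi @^-1: e) e'2); rewrite //= -eE.
Qed.

(** A copy of K_m is determined by its vertex set, since its edges must be all
    pairs of its vertices; counting copies is counting cliques. *)
Lemma copies_completeE m E :
  copies (complete_graph m) E = [set (h, pairs h) | h in cliques m E].
Proof.
apply/setP => X; rewrite inE; apply/andP/imsetP => [[] | [h]].
  case: X => h P /andP[/= PE _] /existsP[phi /existsP[f]].
  move=> /and5P[/injectiveP inj_phi /eqP /= phih _ /eqP /= fP /'forall_eqP fE].
  have PhE : P = pairs h.
    by rewrite -phih -imset_complete_ends // -fP; apply: eq_imset.
  exists h; last by rewrite PhE.
  by rewrite inE -PhE PE -phih card_imset // cardsT card_ord eqxx.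
rewrite inE => /andP[/eqP <- hE] ->; split.
  rewrite /subhypergraph /= hE; apply/forall_inP => e.
  by rewrite !inE => /andP[].
pose phi := [ffun j : 'I_#|h| => enum_val j].
have inj_phi : injective phi.
  by move=> j j'; rewrite !ffunE; apply: enum_val_inj.
have phih : phi @: setT = h.
  apply/setP => x; apply/imsetP/idP => [[j _ ->] | xh].
    by rewrite ffunE enum_valP.
  by exists (enum_rank_in xh x); rewrite // ffunE enum_rankK_in.
apply/existsP; exists phi.
apply/existsP; exists [ffun e : edge (complete_graph #|h|) => phi @: ends e].
apply/and5P; split.
- exact/injectiveP.
- by rewrite phih.
- by apply/injectiveP => e e'; rewrite !ffunE => /(imset_inj inj_phi)/val_inj.
- rewrite -[X in pairs X]phih -imset_complete_ends //; apply/eqP.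
  by apply: eq_imset => e; rewrite ffunE.
- by apply/forallP => e; rewrite ffunE.
Qed.

Lemma card_copies_complete m E : #|copies (complete_graph m) E| = #|cliques m E|.
Proof. by rewrite copies_completeE card_imset // => h h' []. Qed.

(** * Shadows of hypergraphs *)

Definition shadow E : {set {set T}} :=
  [set e : {set T} | (#|e| == 2) && [exists h in E, e \subset h]].

(** A walk records the membership of each vertex in the hyperedge leaving it
    only through its next step, so at least one step is needed. *)
Lemma incident_walk_mem p b q : path incident p (rcons b q) -> p.1 \in p.2.
Proof. by case: b => [|r b] /= /andP[/andP[]]. Qed.

(** The shortcut: when p and q carry the same hyperedge, the step leaving p can
    be replaced by a step leaving q. *)
Lemma incident_walk_restart (p q : T * {set T}) b :
  p.2 = q.2 -> q.1 \in q.2 -> path incident p b -> path incident q b.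
Proof.
by case: b => //= r b pq qq /andP[/andP[_ rp] ->]; rewrite /incident qq -pq rp.
Qed.

Lemma repeated_hyperedge b : ~~ uniq (unzip2 b) ->
  exists p q b1 b2 b3, b = b1 ++ p :: b2 ++ q :: b3 /\ p.2 = q.2.
Proof.
elim: b => //= p b IHb; rewrite negb_and negbK => /orP[/mapP[q qb pq] | /IHb].
  by case/splitPr: qb => b2 b3; exists p, q, [::], b2, b3.
by move=> [q [r [b1 [b2 [b3 [-> qr]]]]]]; exists q, r, (p :: b1), b2, b3.
Qed.

(** Strong induction on the length.  If a hyperedge h repeats, it splits the walk
    into two arcs, each of which is closed up by h into a shorter walk; some
    hyperedge other than h lies on one of the arcs, and that arc is kept.  Having
    two different hyperedges also forces the final length to be at least 2. *)
Lemma berge_cycle_of_closed_walk E b :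
    uniq (unzip1 b) -> {subset unzip2 b <= E} -> cycle incident b ->
    (forall h, has (fun p => p.2 != h) b) ->
  exists2 i, 2 <= i <= size b & ~~ berge_free (cycle_graph i) E.
Proof.
have [m] := ubnP (size b); elim: m b => // m IHm b.
rewrite ltnS => bm b1_uniq bE b_cyc b_nc.
have [b2_uniq | /repeated_hyperedge] := boolP (uniq (unzip2 b)).
  exists (size b); last by apply/berge_free_cycleP; exists b.
  rewrite leqnn andbT; case: (b) b_nc => [/(_ set0) // | p [/(_ p.2) /= | //]].
  by rewrite eqxx.
(* The two arcs between the repetitions of a hyperedge play symmetric roles, so
   it is enough to close up the one that follows p, starting it at q instead. *)
have arc p q A B : p.2 = q.2 -> perm_eq b (p :: A ++ q :: B) ->
    path incident p (rcons A q) -> path incident q (rcons B p) ->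
    has (fun r => r.2 != p.2) A ->
  exists2 i, 2 <= i <= size b & ~~ berge_free (cycle_graph i) E.
  move=> pq bpq pA qB ncA.
  have szA : size (q :: A) < size b.
    by rewrite (perm_size bpq) /= size_cat /= addnS !ltnS leq_addr.
  have sub_b : {subset q :: A <= b}.
    move=> r; rewrite (perm_mem bpq) !inE mem_cat inE.
    by case/orP=> ->; rewrite !orbT.
  have [] := IHm (q :: A).
  - exact: leq_trans szA bm.
  - move: b1_uniq; rewrite (perm_uniq (perm_map _ bpq)) /= map_cat cat_uniq /=.
    by rewrite negb_or => /and3P[_ -> /andP[/andP[->]]].
  - by move=> h /mapP[r /sub_b rb ->]; apply/bE/map_f.
  - exact: incident_walk_restart pq (incident_walk_mem qB) pA.
  - move=> h /=; have [<- | //] := eqVneq q.2 h.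
    by rewrite -pq.
  move=> i /andP[i_ge2 iA] Ei; exists i => //.
  by rewrite i_ge2 (leq_trans iA) // ltnW.
move=> [p [q [b1 [A [b3 [bE' pq]]]]]].
have bpq : perm_eq b (p :: A ++ q :: (b3 ++ b1)).
  by rewrite bE' perm_catC /= -catA.
have [pA qB] :
    path incident p (rcons A q) /\ path incident q (rcons (b3 ++ b1) p).
  move: b_cyc; rewrite bE' cycle_catC /= -catA /= rcons_cat /= cat_path /=.
  by case/and3P=> pA Aq qB; rewrite rcons_path pA Aq.
have := b_nc p.2; rewrite (perm_has _ bpq) /= eqxx has_cat /= -pq eqxx /=.
case/orP=> [| ncB]; first exact: arc pq bpq pA qB.
apply: arc (esym pq) _ qB pA _; last by rewrite -pq.
by rewrite (perm_trans bpq) // -!cat_cons perm_catC.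
Qed.

(** The cycle is longer than a hyperedge is large, so no hyperedge contains all
    its vertices: the closed walk of chosen hyperedges is not constant. *)
Lemma shadow_cycle E r s :
    uniform r E -> r < size s -> uniq s -> cycle (adjacent (shadow E)) s ->
  exists2 i, 2 <= i <= size s & ~~ berge_free (cycle_graph i) E.
Proof.
move=> /forall_inP Er rs s_uniq s_cyc.
pose hyp x := odflt set0 [pick h in E | [set x; next s x] \subset h].
have hypP x : x \in s -> hyp x \in E /\ [set x; next s x] \subset hyp x.
  move=> xs; rewrite /hyp; case: pickP => [h /andP[] // | no_h].
  have := next_cycle s_cyc xs; rewrite /adjacent inE => /andP[_ /exists_inP[h hE sh]].
  by have := no_h h; rewrite hE sh.
pose b := [seq (x, hyp x) | x <- s].
rewrite -(size_map (fun x => (x, hyp x)) s).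
apply: berge_cycle_of_closed_walk.
- by rewrite /unzip1 -map_comp map_id.
- by move=> h; rewrite /unzip2 -map_comp => /mapP[x /hypP[hE _] ->].
- rewrite cycle_map; apply: cycle_from_next => // x xs.
  have [_] := hypP x xs; rewrite subUset !sub1set /=.
  by [].
move=> h; apply: contraLR rs => /hasPn all_h; rewrite -leqNgt.
have hypE x : x \in s -> hyp x = h.
  by move=> xs; apply/eqP; have := all_h _ (map_f _ xs); rewrite negbK.
have [-> // | [x xs]] : s = [::] \/ exists x, x \in s.
  by case: (s) => [|x s']; [left | right; exists x; rewrite mem_head].
rewrite -(eqP (Er h _)); last by rewrite -(hypE x xs); case: (hypP x xs).
rewrite -(card_uniqP s_uniq); apply/subset_leq_card/subsetP => y ys.
by have [_] := hypP y ys; rewrite hypE // subUset sub1set => /andP[].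
Qed.

(** * Berge cycles of triangles *)

Lemma adjacent_clique m E h x y :
  h \in cliques m E -> x \in h -> y \in h -> x != y -> adjacent E x y.
Proof.
rewrite inE => /andP[_ /subsetP hE] xh yh xy; apply: hE.
by rewrite !inE subUset !sub1set xh yh cards2 xy.
Qed.

Lemma third_vertex (h : {set T}) u v : #|h| = 3 -> u \in h -> v \in h -> u != v ->
  exists a, [/\ a != u, a != v & h = [set u; v; a]].
Proof.
move=> h3 uh vh uv.
have uvh : [set u; v] \subset h by rewrite subUset !sub1set uh vh.
have /cards1P[a hE] : #|h :\: [set u; v]| == 1.
  by rewrite cardsD (setIidPr uvh) h3 cards2 uv.
have := set11 a; rewrite -hE !inE negb_or => /andP[/andP[au av] _].
by exists a; split; rewrite // -(setID h [set u; v]) (setIidPr uvh) hE.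
Qed.

(** The bound [maxn 4 (size b)] covers lengths 2 and 3, where the third vertices
    of the triangles are needed to reach a cycle of length 4. *)
Lemma triangle_berge_cycle E b :
    1 < size b -> uniq (unzip1 b) -> uniq (unzip2 b) ->
    {subset unzip2 b <= cliques 3 E} -> cycle incident b ->
  exists s, [/\ 4 <= size s <= maxn 4 (size b), uniq s & cycle (adjacent E) s].
Proof.
have card3 h : h \in cliques 3 E -> #|h| = 3 by rewrite inE => /andP[/eqP].
have C4 u a v c : uniq [:: u; a; v; c] ->
    [/\ adjacent E u a, adjacent E a v, adjacent E v c & adjacent E c u] ->
    exists s, [/\ 4 <= size s <= maxn 4 (size b), uniq s & cycle (adjacent E) s].
  move=> C4_uniq [Eua Eav Evc Ecu]; exists [:: u; a; v; c]; split=> //.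
    by rewrite /= leq_maxl.
  by rewrite /= Eua Eav Evc Ecu.
move=> b_gt1 b1_uniq b2_uniq bE b_cyc.
have [b_ge4 | ] := boolP (4 <= size b).
  exists (unzip1 b); split => //; first by rewrite size_map b_ge4 leq_maxr.
  have b_neq : cycle (relpre fst (fun x y => x != y)) b.
    by rewrite -cycle_map uniq_cycle_neq ?size_map.
  rewrite cycle_map.
  have all_b : all (mem b) b by apply/allP.
  apply: (sub_in_cycle _ all_b)
    (_ : cycle [rel p q | incident p q && (p.1 != q.1)] b).
    move=> p q pb _ /= /andP[/andP[]]; apply: adjacent_clique.
    by apply/bE/map_f.
  by rewrite cycle_relI b_cyc b_neq.
case: b b_gt1 {C4} (C4) b1_uniq b2_uniq bE b_cyc => [|[u h] [|[v h'] b]] //= _ C4.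
case: b C4 => [|[w h''] [|//]] C4 /=.
  (* Length 2: the third vertices a and c differ, as the triangles do. *)
  rewrite !inE !andbT => uv hh' bE /andP[/andP[/= uh vh] /andP[/= vh' uh']] _.
  have hE : h \in cliques 3 E by apply: bE; rewrite !inE eqxx.
  have hE' : h' \in cliques 3 E by apply: bE; rewrite !inE eqxx orbT.
  have [a [au av ha]] := third_vertex (card3 _ hE) uh vh uv.
  have [c [cu cv hc]] := third_vertex (card3 _ hE') uh' vh' uv.
  have ah : a \in h by rewrite ha !inE eqxx orbT.
  have ch : c \in h' by rewrite hc !inE eqxx orbT.
  have ac : a != c by apply: contraNneq hh' => ac; rewrite ha hc ac.
  apply: (C4 u a v c).
    rewrite /= !inE !negb_or (eq_sym u a) au uv (eq_sym u c) cu av ac.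
    by rewrite (eq_sym v c) cv.
  split.
  - by apply: (adjacent_clique hE); rewrite // eq_sym.
  - exact: (adjacent_clique hE).
  - by apply: (adjacent_clique hE'); rewrite // eq_sym.
  - exact: (adjacent_clique hE').
rewrite !inE !andbT !negb_or.
move=> /andP[/andP[uv uw] vw] /andP[/andP[hh' _] _] bE.
move=> /and3P[/andP[/= uh vh] /andP[/= vh' wh'] /andP[/= wh'' uh'']] _.
have hE : h \in cliques 3 E by apply: bE; rewrite !inE eqxx.
have hE' : h' \in cliques 3 E by apply: bE; rewrite !inE eqxx orbT.
have hE'' : h'' \in cliques 3 E by apply: bE; rewrite !inE eqxx !orbT.
have Evw := adjacent_clique hE' vh' wh' vw.
have Euv := adjacent_clique hE uh vh uv.
have Ewu : adjacent E w u by apply: (adjacent_clique hE''); rewrite // eq_sym.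
have [a [au av ha]] := third_vertex (card3 _ hE) uh vh uv.
have [c [cv cw hc]] := third_vertex (card3 _ hE') vh' wh' vw.
have ah : a \in h by rewrite ha !inE eqxx orbT.
have ch : c \in h' by rewrite hc !inE eqxx orbT.
(* Length 3: if the triangle on uv is the core itself, the one on vw is not. *)
have [aw | aw] := eqVneq a w.
  have cu : c != u.
    apply: contraNneq hh' => cu; rewrite ha hc aw cu; apply/eqP/setP => x.
    by rewrite !inE -orbA orbC.
  apply: (C4 v c w u).
    rewrite /= !inE !negb_or (eq_sym v c) cv vw (eq_sym v u) uv cw cu.
    by rewrite (eq_sym w u) uw.
  split => //.
  - by apply: (adjacent_clique hE'); rewrite // eq_sym.
  - exact: (adjacent_clique hE').
apply: (C4 u a v w).
  by rewrite /= !inE !negb_or (eq_sym u a) au uv uw av aw vw.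
split => //.
- by apply: (adjacent_clique hE); rewrite // eq_sym.
- exact: (adjacent_clique hE).
Qed.

End Graphs.

Theorem proposition19 (k n : nat) (hk : 4 <= k) (hn : 1 <= n) :
  ex_berge 3 n [seq cycle_graph i | i <- index_iota 2 k.+1] =
  ex_copies n (complete_graph 3) [seq cycle_graph i | i <- index_iota 4 k.+1].
Proof.
rewrite /ex_berge /ex_copies; apply/eqP; rewrite eqn_leq; apply/andP; split.
  apply/bigmax_leqP => E /andP[E3]; rewrite all_map => /allP E_free.
  have shadow_ok : uniform 2 (shadow E) &&
      all (fun F => subgraph_free F (shadow E))
          [seq cycle_graph i | i <- index_iota 4 k.+1].
    apply/andP; split; first by apply/forall_inP => e; rewrite inE => /andP[].
    rewrite all_map; apply/allP => i; rewrite mem_index_iota ltnS => /andP[i_ge4 ik] /=.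
    apply/contraT => /(subgraph_free_cycleP _ (ltnW i_ge4))[s [sz s_uniq s_cyc]].
    have [|j] := shadow_cycle E3 _ s_uniq s_cyc; first by rewrite sz.
    rewrite sz => /andP[j_ge2 ji] /negP[]; apply: E_free.
    by rewrite mem_index_iota j_ge2 ltnS (leq_trans ji).
  apply: leq_trans (leq_bigmax_cond (shadow E) shadow_ok).
  rewrite card_copies_complete; apply/subset_leq_card/subsetP => h hE.
  rewrite inE (forall_inP E3 h hE); apply/subsetP => e; rewrite !inE.
  by move=> /andP[eh ->]; apply/exists_inP; exists h.
apply/bigmax_leqP => E /andP[_]; rewrite all_map => /allP E_free.
have cliques_ok : uniform 3 (cliques 3 E) &&
    all (fun F => berge_free F (cliques 3 E))
        [seq cycle_graph i | i <- index_iota 2 k.+1].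
  apply/andP; split; first by apply/forall_inP => h; rewrite inE => /andP[].
  rewrite all_map; apply/allP => i; rewrite mem_index_iota ltnS => /andP[i_ge2 ik] /=.
  apply/contraT => /berge_free_cycleP[b [sz b1_uniq b2_uniq bE b_cyc]].
  have [|s [/andP[s_ge4 s_le] s_uniq s_cyc]] :=
    triangle_berge_cycle _ b1_uniq b2_uniq bE b_cyc; first by rewrite sz.
  have /negP[] : ~~ subgraph_free (cycle_graph (size s)) E.
    by apply/subgraph_free_cycleP; [exact: ltnW | exists s].
  apply: E_free; rewrite mem_index_iota s_ge4 ltnS (leq_trans s_le) //.
  by rewrite geq_max hk sz ik.
rewrite card_copies_complete; exact: leq_bigmax_cond (cliques 3 E) cliques_ok.
Qed.
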